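(* Let $\mathcal{H}$ be a nonempty finite class of hypotheses $h:X\to\{-1,+1\}$, let $D$ be a probability distribution on $X\times\{-1,+1\}$, let $\epsilon=\min\{\varepsilon(h):h\in\mathcal{H}\}$, and let $m$ be a positive integer. Let $0<\theta<1/2$, $0<\delta<1$, and $$\eta=\ln(8|\mathcal{H}|)\,m^{1/2-\theta},\qquad \Delta=2\sqrt{\frac{\ln(\sqrt2/\delta)}{m}}+\frac{\ln(8|\mathcal{H}|)}{8m^{1/2+\theta}}.$$ If $m\ge8$, then $$\Pr_{(x,y)\sim D}[y\,\ell_\eta(x)\le0]\le\left(2+\frac1{4m}\right)\left(\epsilon+\frac1{m^{1/2-\theta}}+\frac{\ln m}{m^{1/2-\theta}\ln(8|\mathcal{H}|)}\right),$$ and if $$m\ge\left[8\sqrt{\ln\left(\frac{\sqrt2}{\delta}\right)}\,\ln(8|\mathcal{H}|)\right]^{1/\theta},$$ then $$\Pr_{(x,y)\sim D}[y\,\ell_\eta(x)\le2\Delta]\le5\left(\epsilon+2\Delta+\frac1{m^{1/2-\theta}}\right).$$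
   Context: $X$ is a measurable space and all hypotheses are measurable. For $h\in\mathcal{H}$, the true error is $\varepsilon(h)=\Pr_{(x,y)\sim D}[h(x)\ne y]$. For $\eta>0$ and $x\in X$, the true log ratio is $$\ell_\eta(x)=\frac1\eta\ln\frac{\sum_{h\in\mathcal{H}:h(x)=+1}e^{-\eta\varepsilon(h)}}{\sum_{h\in\mathcal{H}:h(x)=-1}e^{-\eta\varepsilon(h)}},$$ with the convention $\ell_\eta(x)=+\infty$ if all hypotheses predict $+1$ on $x$, and $\ell_\eta(x)=-\infty$ if all hypotheses predict $-1$ on $x$. *)

(* Defs.v *)
From mathcomp Require Export all_boot all_order all_algebra finmap.
From mathcomp Require Export all_classical all_reals all_analysis.
Export Order.TTheory GRing.Theory Num.Theory.
Export numFieldNormedType.Exports.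

Set Implicit Arguments.
Unset Strict Implicit.
Unset Printing Implicit Defensive.

Local Open Scope classical_set_scope.
Local Open Scope ring_scope.

(* The label set {-1, +1} is represented by bool with its discrete
   sigma-algebra: true is the label +1 and false is the label -1. *)
Definition label_sign (R : realType) (y : bool) : R := if y then 1 else -1.

Definition true_error (d : measure_display) (X : measurableType d)
    (R : realType) (D : probability (X * bool)%type R) (h : X -> bool) : R :=
  fine (D [set z | h z.1 <> z.2]).

Definition label_weight (d : measure_display) (X : measurableType d)
    (R : realType) (D : probability (X * bool)%type R)
    (H : {fset (X -> bool)}) (eta : R) (x : X) (b : bool) : R :=
  \sum_(h <- H | h x == b) expR (- (eta * true_error D h)).

(* Extended-real valued; on a nonempty H at most one of the two unanimity
   tests can succeed, so their order is irrelevant. *)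
Definition true_log_ratio (d : measure_display) (X : measurableType d)
    (R : realType) (D : probability (X * bool)%type R)
    (H : {fset (X -> bool)}) (eta : R) (x : X) : \bar R :=
  if all (fun h : X -> bool => h x) H then +oo%E
  else if all (fun h : X -> bool => ~~ h x) H then -oo%E
  else (eta^-1 * ln (label_weight D H eta x true /
                     label_weight D H eta x false))%:E.

Definition is_min (R : realType) (A : set R) (a : R) : Prop :=
  A a /\ lbound A a.

(* Main.v *)
Require Import Defs.
From mathcomp Require Import measurable_realfun ring lra.
(** Write [w h = exp (- eta * err h)] for the weight of a hypothesis, [Z] for
the total weight, and [W x b] for the weight of the hypotheses predicting [b]
on [x].  The score [y * l(x)] is at most [lam] exactly when
[W x y <= exp (eta * lam) * W x (~~ y)], conventions at infinity included
([label_sign_log_ratio_le]).  Since the two weights add up to [Z], this says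
that the weight of the hypotheses that err on [(x, y)] is at least the fraction
[1 / (1 + exp (eta * lam))] of [Z].  The expectation of that erring weight is
the sum of [w h * err h], so Markov's inequality ([markov_weighted_count])
bounds the probability of the event by [1 + exp (eta * lam)] times the
[w]-weighted mean of the errors.

This mean is close to the least error [eps].  For every slack [g], the number
[u = err h - (eps + g)] satisfies [eta * u * exp (- eta * u) <= 1], so a
hypothesis that is much worse than [eps + g] is damped by its own weight; since
the best hypothesis alone gives [Z >= exp (- eta * eps)], the mean is at most
[eps + g + #|H| * exp (- eta * g) / eta] ([gibbs_mean_le]).  The result is
[log_ratio_tail], of which both claims are instances; put
[p = m ^ (1/2 - theta)] and [L = ln (8 #|H|)], so [eta = L * p].

For [lam = 0], the slack [g = 1/p + ln m / (p L)] makes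
[eta * g = ln (8 #|H| m)], so the last term is [1 / (8 m eta)], at most
[g / (8 m)] as [eta * g >= 1]; the factor [2 = 1 + exp 0] turns the resulting
[1 + 1/(8m)] into [2 + 1/(4m)].

For [lam = 2 Delta], the slack [g = 1/p] makes the last term [1 / (8 eta)], at
most [g / 8].  The lower bound on [m] keeps [2 * eta * Delta] at most [3/5],
hence [exp (2 * eta * Delta) <= 3], and [4 * (1 + 1/8) <= 5]. *)

Set Implicit Arguments.
Unset Strict Implicit.
Unset Printing Implicit Defensive.
Local Open Scope classical_set_scope.
Local Open Scope ring_scope.
Lemma mulr_expRN_le1 (R : realType) (x : R) : x * expR (- x) <= 1.
Proof.
rewrite expRN ler_pdivrMr ?expR_gt0// mul1r.
by have := expR_ge1Dx x; lra.
Qed.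

(** The bound holds term by term, and the excess of each term over its share of
[a + g] is at most [exp (- eta * (a + g)) / eta], whether [f h] exceeds
[a + g] or not.  The element [t] serves to bound the total weight
below by [exp (- eta * a)], which makes the accumulated excess proportional to
the total weight. *)
Lemma gibbs_mean_le (R : realType) (T : eqType) (s : seq T) (f : T -> R)
    (eta a g : R) (t : T) :
  0 < eta -> t \in s -> f t <= a ->
  \sum_(h <- s) expR (- (eta * f h)) * f h <=
  (\sum_(h <- s) expR (- (eta * f h))) *
  (a + g + (size s)%:R * expR (- (eta * g)) / eta).
Proof.
move=> eta0 ts fta; set Z := \sum_(h <- s) expR _.
have Zt : expR (- (eta * a)) <= Z.
  rewrite /Z (big_rem t ts) /=; apply: ler_wpDr.
    by apply: sumr_ge0 => i _; exact: expR_ge0.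
  by rewrite ler_expR lerN2 ler_wpM2l // ltW.
have term h : expR (- (eta * f h)) * f h <=
    expR (- (eta * f h)) * (a + g) +
    expR (- (eta * a)) * (expR (- (eta * g)) / eta).
  rewrite addrC -lerBlDr -mulrBr mulrA ler_pdivlMr// -mulrA.
  set u := eta * (f h - (a + g)).
  have -> : (f h - (a + g)) * eta = u by rewrite mulrC.
  have -> : - (eta * f h) = - (eta * a) + - (eta * g) + - u by rewrite /u; ring.
  rewrite !expRD -[X in X <= _]mulrA ler_piMr ?mulr_ge0 ?expR_ge0// mulrC.
  exact: mulr_expRN_le1.
apply: (le_trans (ler_sum _ (fun h _ => term h))).
rewrite big_split/= -mulr_suml big_const_seq count_predT iter_addr_0.
rewrite -/Z [leRHS]mulrDr lerD2l -[leLHS]mulr_natl mulrCA -[in leRHS]mulrA.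
apply: ler_wpM2r Zt; apply: mulr_ge0 => //.
by rewrite divr_ge0 ?expR_ge0// ltW.
Qed.

(** Markov's inequality for a weighted count of the events [E i] that occur,
whose expectation is known by linearity. *)
Lemma markov_weighted_count (d : measure_display) (T : measurableType d)
    (R : realType) (P : probability T R) (I : eqType) (s : seq I) (w : I -> R)
    (E : I -> set T) (c : R) :
  0 < c -> (forall i, 0 <= w i) -> (forall i, i \in s -> measurable (E i)) ->
  (P [set z | (c <= \sum_(i <- s) w i * \1_(E i) z)%R]
   <= ((\sum_(i <- s) w i * fine (P (E i))) / c)%:E)%E.
Proof.
move=> c0 w0 mE.
(* Indexing by positions makes measurability hold for every index, whereas [E]
   is only assumed measurable on the members of [s]. *)
rewrite big_tnth.
set F := fun z => \sum_(i <- s) w i * \1_(E i) z.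
set t := tnth (in_tuple s).
have mEt i : measurable (E (t i)) by apply: mE; exact: mem_tnth.
have FE : F = fun z => \sum_(i < size s) w (t i) * \1_(E (t i)) z.
  by apply/funext => z; rewrite /F big_tnth.
have mterm i : measurable_fun setT (fun z => w (t i) * \1_(E (t i)) z : R).
  by apply: measurable_funM => //; exact: measurable_realfun.measurable_indic.
have mF : measurable_fun setT F by rewrite FE; exact: measurable_sum.
have F0 z : 0 <= F z by apply: sumr_ge0 => i _; rewrite mulr_ge0.
have intF : (\int[P]_z (F z)%:E =
    (\sum_(i < size s) w (t i) * fine (P (E (t i))))%:E)%E.
  under eq_integral do rewrite FE -sumEFin.
  rewrite ge0_integral_sum//=; first last.
  - by move=> i z _; rewrite lee_fin mulr_ge0.
  - by move=> i; apply/measurable_EFinP.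
  rewrite -sumEFin; apply: eq_bigr => i _.
  under eq_integral do rewrite EFinM.
  rewrite ge0_integralZl_EFin//=; first last.
  - by apply/measurable_EFinP; exact: measurable_indic.
  by rewrite integral_indic// setIT EFinM fineK// fin_num_measure.
rewrite EFinM muleC lee_pdivlMl// -intF.
have mEF : measurable_fun setT (EFin \o F) by exact/measurable_EFinP.
have := @le_integral_comp_abse _ _ _ P setT measurableT (EFin \o F) c id
  (@measurable_id _ _ _) (fun _ h => h) (fun _ _ _ _ h => h) mEF c0.
have absF z : `|(EFin \o F) z|%E = (F z)%:E by rewrite /= ger0_norm.
rewrite setTI (eq_integral (fun z => (F z)%:E)) => [|z _]; last exact: absF.
congr (_ * P _ <= _)%E.
by apply: eq_set => z; rewrite absF lee_fin.
Qed.
Lemma label_weight_gt0 (d : measure_display) (X : measurableType d)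
    (R : realType) (D : probability (X * bool)%type R)
    (H : {fset (X -> bool)}) (eta : R) (x : X) (b : bool) :
  (0 < label_weight D H eta x b) = has (fun h : X -> bool => h x == b) H.
Proof.
rewrite /label_weight; elim: (H : seq _) => [|h s IH]; first by rewrite big_nil ltxx.
rewrite big_cons /=; case: ifP => //= _.
by rewrite ltr_pwDl ?expR_gt0// sumr_ge0// => i _; exact: expR_ge0.
Qed.

Lemma label_weight_ge0 (d : measure_display) (X : measurableType d)
    (R : realType) (D : probability (X * bool)%type R)
    (H : {fset (X -> bool)}) (eta : R) (x : X) (b : bool) :
  0 <= label_weight D H eta x b.
Proof. by apply: sumr_ge0 => h _; exact: expR_ge0. Qed.

(** The ratio of the two weights is at most (or at least) a given number iff
the cross-multiplied inequality holds; in that form the unanimous cases need no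
convention, because one of the weights is then zero and the other positive. *)
Lemma label_sign_log_ratio_le (d : measure_display) (X : measurableType d)
    (R : realType) (D : probability (X * bool)%type R)
    (H : {fset (X -> bool)}) (eta lam : R) (x : X) (y : bool) :
  0 < eta -> H != fset0 ->
  ((label_sign R y)%:E * true_log_ratio D H eta x <= lam%:E)%E =
  (label_weight D H eta x y <= expR (eta * lam) * label_weight D H eta x (~~ y)).
Proof.
move=> eta0 /fset0Pn[h0 h0H].
have posW b : has (fun h : X -> bool => h x == b) H ->
  0 < label_weight D H eta x b by rewrite label_weight_gt0.
have W0 b : ~~ has (fun h : X -> bool => h x == b) H ->
  label_weight D H eta x b = 0.
  rewrite -(label_weight_gt0 D _ eta) -leNgt => W_le0.
  by apply/eqP; rewrite eq_le W_le0 label_weight_ge0.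
have unanimous b : all (fun h : X -> bool => h x == b) H ->
  0 < label_weight D H eta x b /\ label_weight D H eta x (~~ b) = 0.
  move=> /allP Hb; split; first by apply/posW/hasP; exists h0 => //; exact: Hb.
  apply/W0/hasPn => h /Hb /eqP ->; by case: b {Hb}.
rewrite /true_log_ratio; case: ifPn => [/(@sub_all _ _ (fun h => h x == true))|].
  move=> /(_ (fun h hx => introT eqP hx)) /unanimous[Wt Wf].
  case: y => /=; rewrite ?Wf.
    by rewrite mul1e mulr0 leye_eq/= leNgt Wt.
  by rewrite mulN1e leNye mulr_ge0 ?expR_ge0// ltW.
move=> /allPn[h hH hx]; case: ifPn => [/(@sub_all _ _ (fun h => h x == false))|].
  move=> /(_ (fun h hx' => introT eqP (negbTE hx'))) /unanimous[Wf Wt].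
  case: y => /=; rewrite ?Wt.
    by rewrite mul1e leNye mulr_ge0 ?expR_ge0// ltW.
  by rewrite mulN1e leye_eq/= mulr0 leNgt Wf.
move=> /allPn[h' h'H h'x].
have Wf : 0 < label_weight D H eta x false.
  by apply/posW/hasP; exists h => //; rewrite (negbTE hx).
have Wt : 0 < label_weight D H eta x true.
  by apply/posW/hasP; exists h' => //; rewrite eqb_id -(negbK (h' x)).
have lnE a b : 0 < a -> 0 < b ->
    (eta^-1 * ln (a / b) <= lam) = (a <= expR (eta * lam) * b).
  move=> a0 b0; rewrite mulrC ler_pdivrMr// -ler_expR lnK ?posrE ?divr_gt0//.
  by rewrite ler_pdivrMr// (mulrC lam).
case: y => /=; rewrite lee_fin; first by rewrite mul1r lnE.
by rewrite mulN1r -mulrN -lnV ?posrE ?divr_gt0// invf_div lnE.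
Qed.

(** The two labels are separated so that each piece is a measurable rectangle. *)
Lemma measurable_error_set (d : measure_display) (X : measurableType d)
    (h : X -> bool) :
  measurable_fun setT h -> measurable [set z : X * bool | h z.1 <> z.2].
Proof.
move=> mh.
have mh1 : measurable_fun [set: X * bool] (h \o fst).
  exact: measurableT_comp mh measurable_fst.
have -> : [set z : X * bool | h z.1 <> z.2] =
    ((h \o fst) @^-1` [set true] `&` snd @^-1` [set false]) `|`
    ((h \o fst) @^-1` [set false] `&` snd @^-1` [set true]).
  by apply/seteqP; split => -[x []] /=; case: (h x) => //=; intuition congruence.
by apply: measurableU; apply: measurableI; rewrite -[X in measurable X]setTI;
  [apply: mh1|apply: measurable_snd|apply: mh1|apply: measurable_snd].
Qed.
(** The bound common to both claims, at an arbitrary threshold [lam] and slack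
[g]; [h0] is meant to be a hypothesis of least error, but any member of the
class gives a valid bound. *)
Lemma log_ratio_tail (R : realType) (d : measure_display) (X : measurableType d)
    (H : {fset (X -> bool)}) (D : probability (X * bool)%type R)
    (h0 : X -> bool) (eta lam g : R) :
  (forall h : X -> bool, h \in H -> measurable_fun setT h) ->
  h0 \in H -> 0 < eta ->
  (D [set z | (label_sign R z.2)%:E * true_log_ratio D H eta z.1 <= lam%:E]
   <= ((1 + expR (eta * lam)) *
       (true_error D h0 + g + #|` H|%:R * expR (- (eta * g)) / eta))%:E)%E.
Proof.
move=> mH h0H eta0.
have H0 : H != fset0 by apply/fset0Pn; exists h0.
pose w h := expR (- (eta * true_error D h)).
pose Z := \sum_(h <- H) w h.
pose E (h : X -> bool) : set (X * bool) := [set z | h z.1 <> z.2].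
have q0 : 0 < 1 + expR (eta * lam) by rewrite addr_gt0 ?expR_gt0.
have Z0 : 0 < Z.
  rewrite /Z (big_rem h0 h0H) /= ltr_pwDl ?expR_gt0// sumr_ge0// => h _.
  exact: expR_ge0.
(* The event is an upper level set of the erring weight, which gives both its
   measurability and the form required by Markov's inequality. *)
have -> : [set z | ((label_sign R z.2)%:E * true_log_ratio D H eta z.1
      <= lam%:E)%E] =
    [set z | Z / (1 + expR (eta * lam)) <= \sum_(h <- H) w h * \1_(E h) z].
  apply: eq_set => -[x y] /=; rewrite label_sign_log_ratio_le//; congr is_true.
  have -> : \sum_(h <- H) w h * \1_(E h) (x, y) = label_weight D H eta x (~~ y).
    rewrite /label_weight [RHS]big_mkcond; apply: eq_bigr => h _.
    rewrite indicE /E; have -> : ((x, y) \in E h) = (h x == ~~ y).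
      apply/idP/idP => [|hy]; rewrite inE/=; [move/eqP|apply/eqP; move: hy];
        by case: (h x) y => -[].
    by case: ifP => _; rewrite ?mulr1 ?mulr0.
  have ZE : Z = label_weight D H eta x y + label_weight D H eta x (~~ y).
    rewrite /Z (bigID (fun h : X -> bool => h x == y))/=; congr +%R.
    by apply: eq_bigl => h; case: (h x) y => -[].
  by rewrite ler_pdivrMr// ZE mulrDr mulr1 [in RHS]addrC lerD2l mulrC.
apply: (le_trans (markov_weighted_count _ _ _ _)).
- by rewrite divr_gt0.
- by move=> h; exact: expR_ge0.
- by move=> h /mH; exact: measurable_error_set.
rewrite lee_fin invf_div mulrCA; apply: ler_wpM2l; first exact: ltW.
rewrite ler_pdivrMr// mulrC.
exact: (gibbs_mean_le g eta0 h0H (lexx _)).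
Qed.

Lemma ln2_ge_half (R : realType) : 2^-1 <= ln 2 :> R.
Proof.
have := @le_ln1Dx R (- 2^-1) _; have -> : 1 + - 2^-1 = 2^-1 :> R by lra.
rewrite lnV ?posrE// => h.
suff : - ln 2 <= - 2^-1 :> R by lra.
by apply: h; lra.
Qed.

Theorem corollary1 (R : realType) (d : measure_display) (X : measurableType d)
  (H : {fset (X -> bool)}) (D : probability (X * bool)%type R)
  (eps theta delta eta Delta : R) (m : nat)
  (H_nonempty : H != fset0)
  (H_measurable : forall h : X -> bool, h \in H -> measurable_fun setT h)
  (eps_min : is_min [set true_error D h | h in [set` H]] eps)
  (m_gt0 : (0 < m)%N)
  (theta_gt0 : 0 < theta) (theta_lt : theta < 2^-1)
  (delta_gt0 : 0 < delta) (delta_lt1 : delta < 1)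
  (eta_def : eta = ln (8 * #|` H|%:R) * m%:R `^ (2^-1 - theta))
  (Delta_def : Delta = 2 * Num.sqrt (ln (Num.sqrt 2 / delta) / m%:R)
                 + ln (8 * #|` H|%:R) / (8 * m%:R `^ (2^-1 + theta))) :
  ((8 <= m)%N ->
    (D [set z | (label_sign R z.2)%:E * true_log_ratio D H eta z.1 <= 0]
     <= ((2 + (4 * m%:R)^-1) *
         (eps + (m%:R `^ (2^-1 - theta))^-1
          + ln m%:R / (m%:R `^ (2^-1 - theta) * ln (8 * #|` H|%:R))))%:E)%E)
  /\
  ((8 * Num.sqrt (ln (Num.sqrt 2 / delta)) * ln (8 * #|` H|%:R)) `^ (theta^-1)
     <= m%:R ->
    (D [set z | (label_sign R z.2)%:E * true_log_ratio D H eta z.1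
                <= (2 * Delta)%:E]
     <= (5 * (eps + 2 * Delta + (m%:R `^ (2^-1 - theta))^-1))%:E)%E).
Proof.
have [[h0 /= h0H h0eps] _] := eps_min.
set N : R := #|` H|%:R in eta_def Delta_def *.
set L := ln (8 * N) in eta_def Delta_def *.
set p := m%:R `^ (2^-1 - theta) in eta_def *.
have N1 : 1 <= N by rewrite /N ler1n cardfs_gt0.
have m0 : 0 < m%:R :> R by rewrite ltr0n.
have m1 : 1 <= m%:R :> R by rewrite ler1n.
have p0 : 0 < p by rewrite powR_gt0.
have ln2 := ln2_ge_half R.
have L1 : 1 <= L.
  have : ln (2 ^+ 2) <= L by rewrite ler_ln ?posrE; nra.
  by rewrite lnXn// mulr2n; lra.
have expL : expR (- L) = (8 * N)^-1 by rewrite expRN lnK// posrE; lra.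
have eta0 : 0 < eta by rewrite eta_def; apply: mulr_gt0 => //; lra.
have eps0 : 0 <= eps by rewrite -h0eps /true_error fine_ge0.
have tail lam g := @log_ratio_tail R d X H D h0 eta lam g H_measurable h0H eta0.
rewrite h0eps -/N in tail.
split.
- move=> m8; have lnm : 0 <= ln m%:R :> R by exact: ln_ge0.
  rewrite -[eps + _ + _]addrA; set g := p^-1 + _.
  apply: (le_trans (tail 0 g)); rewrite lee_fin mulr0 expR0.
  have etag : eta * g = L + ln m%:R.
    rewrite eta_def /g; field; apply/andP; split; lra.
  have -> : N * expR (- (eta * g)) = (8 * m%:R)^-1.
    rewrite etag opprD expRD expL expRN lnK ?posrE//; field.
    by apply/andP; split; lra.
  have invg : eta^-1 <= g by rewrite -[eta^-1]mul1r ler_pdivrMr// mulrC etag; lra.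
  have : (8 * m%:R)^-1 / eta <= (8 * m%:R)^-1 * (eps + g).
    by rewrite ler_wpM2l ?invr_ge0; lra.
  have -> : (4 * m%:R)^-1 = 2 * (8 * m%:R)^-1 :> R by field; lra.
  nra.
- move=> m_large; set s := Num.sqrt (ln (Num.sqrt 2 / delta)) in m_large.
  set q := m%:R `^ theta.
  have q0 : 0 < q by rewrite powR_gt0.
  have lns : 4^-1 <= ln (Num.sqrt 2 / delta).
    (* ln (sqrt 2) = ln 2 / 2 >= 1/4, and delta < 1 only helps. *)
    have sqrt2 : ln (Num.sqrt 2) = 2^-1 * ln 2 :> R.
      by rewrite -powR12_sqrt// ln_powR.
    have lnd : ln delta <= 0 by apply: ln_le0; lra.
    rewrite ln_div ?posrE ?sqrtr_gt0//; lra.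
  have s_half : 2^-1 <= s.
    rewrite -(@ler_pXn2r _ 2) ?nnegrE ?sqrtr_ge0// sqr_sqrtr; last lra.
    by rewrite expr2; lra.
  have sLq : 8 * s * L <= q.
    have := @ge0_ler_powR R theta (ltW theta_gt0) _ _ _ _ m_large.
    rewrite -powRrM mulVf ?lt0r_neq0// powRr1; last by nra.
    by apply; rewrite nnegrE ?powR_ge0.
  have sqrtE : Num.sqrt (ln (Num.sqrt 2 / delta) / m%:R) = s / (p * q).
    rewrite sqrtrM; last lra.
    rewrite sqrtrV ?ler0n// -/s -powR12_sqrt ?ler0n// -powRD ?subrK//.
    by apply/implyP => _; rewrite lt0r_neq0.
  have pqq : m%:R `^ (2^-1 + theta) = p * q * q.
    rewrite /p /q -!powRD ?subrK//; by apply/implyP => _; rewrite lt0r_neq0.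
  (* 2 * eta * Delta depends on m only through u = L / m ^ theta, which the
     hypothesis on m bounds by 1 / (8 s) <= 1/4. *)
  have etaD : eta * (2 * Delta) = 4 * (s * (L / q)) + (L / q) ^+ 2 / 4.
    rewrite Delta_def sqrtE pqq eta_def; field; apply/andP; split; lra.
  have u0 : 0 < L / q by rewrite divr_gt0; lra.
  have su : s * (L / q) <= 8^-1 by rewrite mulrA ler_pdivrMr; lra.
  have expD : expR (eta * (2 * Delta)) <= 3.
    have le35 : eta * (2 * Delta) <= 3 / 5 by rewrite etaD; nra.
    (* exp x <= 1 / (1 - x) with x = 3/5 gives 5/2. *)
    have := expR_ge1Dx (- (eta * (2 * Delta))); rewrite expRN => h.
    have : expR (eta * (2 * Delta)) * (2 / 5) <= 1.
      by rewrite mulrC -ler_pdivlMr ?expR_gt0// mul1r; lra.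
    lra.
  have D0 : 0 <= Delta.
    rewrite Delta_def addr_ge0 ?mulr_ge0 ?sqrtr_ge0 ?divr_ge0//; lra.
  have pV : 0 < p^-1 by rewrite invr_gt0.
  apply: (le_trans (tail (2 * Delta) p^-1)); rewrite lee_fin.
  have -> : eta * p^-1 = L by rewrite eta_def; field; lra.
  have -> : N * expR (- L) = 8^-1 by rewrite expL; field; lra.
  have : eta^-1 <= p^-1 by rewrite lef_pV2 ?posrE// eta_def; nra.
  have := expR_gt0 (eta * (2 * Delta)).
  nra.
Qed.
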